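(* Let $\alpha\in(0,\infty)$ and $\lambda\in\mathbb{R}$. If $y\in C[0,b]$ and $t\in(0,b]$, then there exists $c\in(0,t)$ such that $${}^{T}\mathcal{I}^{\alpha,\lambda}_{\Psi}\,y(t)=\left(\Psi(t)-\Psi(0)\right)^{\alpha}e^{-\lambda(\Psi(t)-\Psi(0))}\,E_{1,\alpha+1}\big(\lambda(\Psi(t)-\Psi(0))\big)\cdot y(c).$$
   Context: Throughout, $b>0$ is fixed and $\Psi$ is a smooth monotonic real function on $[0,b]$ with $\Psi'>0$ almost everywhere. For $y$ absolutely $\Psi$-integrable on $[0,b]$ (i.e. $y\in L^1([0,b],\mathrm{d}\Psi)$), the $\Psi$-tempered fractional integral of order $\alpha>0$ and index $\lambda\in\mathbb{R}$ is $${}^{T}\mathcal{I}^{\alpha,\lambda}_{\Psi}y(t)=\frac{1}{\Gamma(\alpha)}\int_0^t\Psi'(s)(\Psi(t)-\Psi(s))^{\alpha-1}e^{-\lambda(\Psi(t)-\Psi(s))}y(s)\,\mathrm{d}s.$$ $E_{p,q}(z)=\sum_{k=0}^\infty \frac{z^k}{\Gamma(pk+q)}$ is the two-parameter Mittag-Leffler function. *)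

(* Defs.v *)
From mathcomp Require Import all_boot all_order all_algebra.
From mathcomp Require Import all_classical all_reals all_analysis.

Set Implicit Arguments.
Unset Strict Implicit.
Unset Printing Implicit Defensive.

Import Order.TTheory GRing.Theory Num.Theory.
Import numFieldNormedType.Exports.

Local Open Scope classical_set_scope.
Local Open Scope ring_scope.

(* Euler's integral; this is the Gamma function only for 0 < x, which covers
   every use below. *)
Definition Gamma (R : realType) (x : R) : R :=
  \int[@lebesgue_measure R]_(s in `]0, +oo[) (s `^ (x - 1) * expR (- s)).

Definition mittag_leffler (R : realType) (p q z : R) : R :=
  limn (series (fun k : nat => z ^+ k / Gamma (p * k%:R + q))).

(* [d] is the derivative of [f] at [x] relative to [A]: the difference quotient
   only uses points of [A], so that it is one-sided at an endpoint of a closed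
   interval. *)
Definition is_derive_within (R : realType) (A : set R) (f : R -> R) (x d : R)
    : Prop :=
  (f z - f x) / (z - x) @[z --> within A x^'] --> d.

(* C^oo on the closed interval [a, b], with one-sided derivatives at a and b;
   [D n] is the n-th derivative.  The values of [f] outside [a, b] are
   irrelevant. *)
Definition smooth_on (R : realType) (a b : R) (f : R -> R) : Prop :=
  exists D : nat -> R -> R,
    {in `[a, b], D 0%N =1 f} /\
    forall n, {in `[a, b], forall x,
      is_derive_within `[a, b] (D n) x (D n.+1 x)}.

Definition monotonic_on (R : realType) (a b : R) (f : R -> R) : Prop :=
  {in `[a, b] &, nondecreasing_fun f} \/ {in `[a, b] &, nonincreasing_fun f}.

(* The two-sided derivative [Psi^`()] may be meaningless at 0 and at t = b, and
   [powR] is total at the base 0 reached for s = t; these points form a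
   Lebesgue-null set. *)
Definition tempered_integral (R : realType) (Psi : R -> R) (alpha lambda : R)
    (y : R -> R) (t : R) : R :=
  (Gamma alpha)^-1 *
  \int[@lebesgue_measure R]_(s in `[0, t])
    (Psi^`()%classic s * (Psi t - Psi s) `^ (alpha - 1) *
     expR (- lambda * (Psi t - Psi s)) * y s).

(* Main.v *)
(* With u = Psi t - Psi s, the kernel Psi' u^(alpha-1) e^(-lambda u) is the
   derivative of - H u, where
     H u = u^alpha e^(-lambda u) P(lambda u),
     P z = sum_k z^k / (alpha (alpha+1) ... (alpha+k)),
   because z P' = 1 + z P - alpha P; by Gamma (x+1) = x Gamma x, H / Gamma alpha
   is the factor of y(c) in the claim. The kernel is positive almost everywhere,
   so the weighted mean value theorem applies: if the mean m of y were not
   attained inside ]0, t[, then y - m would have constant sign there and could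
   not integrate to 0 against the kernel. *)
Require Import Defs.
From mathcomp Require Import all_boot all_order all_algebra.
From mathcomp Require Import all_classical all_reals all_analysis.
From mathcomp Require Import measurable_realfun ring lra.

Import Order.TTheory GRing.Theory Num.Theory.
Import numFieldNormedType.Exports.

Local Open Scope classical_set_scope.
Local Open Scope ring_scope.

(** * Positivity of integrals and the weighted mean value theorem *)

(* [filterS] itself does not apply to the Lebesgue measure: no filter instance
   is found for it. *)
Lemma ae_imply (d : measure_display) (T : measurableType d)
    (R : realType) (mu : {measure set T -> \bar R}) (P Q : T -> Prop) :
  (forall x, P x -> Q x) -> {ae mu, forall x, P x} -> {ae mu, forall x, Q x}.
Proof. exact: filterS. Qed.

Lemma integrable_EFinZl (d : measure_display) (T : measurableType d)
    (R : realType) (mu : {measure set T -> \bar R}) (D : set T) (r : R)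
    (f : T -> R) :
  measurable D -> mu.-integrable D (EFin \o f) ->
  mu.-integrable D (EFin \o (fun x => r * f x)).
Proof. by move=> mD fi; exact: (integrableZl mD r fi). Qed.

Lemma integrable_EFinB (d : measure_display) (T : measurableType d)
    (R : realType) (mu : {measure set T -> \bar R}) (D : set T)
    (f g : T -> R) :
  measurable D -> mu.-integrable D (EFin \o f) ->
  mu.-integrable D (EFin \o g) ->
  mu.-integrable D (EFin \o (fun x => f x - g x)).
Proof. by move=> mD fi gi; exact: (integrableB mD fi gi). Qed.

(** A nonnegative function with integral 0 vanishes almost everywhere; together with positivity
    almost everywhere this would make [D] negligible. *)
Lemma Rintegral_gt0 (d : measure_display) (T : measurableType d) (R : realType)
    (mu : {measure set T -> \bar R}) (D : set T) (f : T -> R) :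
  measurable D -> (0 < mu D)%E -> mu.-integrable D (EFin \o f) ->
  {ae mu, forall x, D x -> 0 < f x} -> 0 < \int[mu]_(x in D) f x.
Proof.
move=> mD muD fi f_gt0.
have mf := measurable_int mu fi.
have f_abs : (\int[mu]_(x in D) (f x)%:E = \int[mu]_(x in D) `|(f x)%:E|)%E.
  apply: ae_eq_integral => //; first exact: measurableT_comp.
  by apply: filterS f_gt0 => x fx Dx /=; rewrite ger0_norm// ltW// fx.
have f_fin : (\int[mu]_(x in D) (f x)%:E)%E \is a fin_num.
  exact: integrable_fin_num.
rewrite -lte_fin /Rintegral fineK// f_abs lt_neqAle integral_ge0// andbT.
apply/negP => /eqP /esym /(ae_eq_integral_abs mu mD mf) f0.
move: muD; suff -> : mu D = 0%E by rewrite ltxx.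
apply/(negligibleP mu mD).
have : {ae mu, forall x, ~ D x}.
  apply: filterS2 f_gt0 f0 => x fx f0x Dx.
  by have := fx Dx; case: (f0x Dx) => ->; rewrite ltxx.
by apply: negligibleS => x Dx /(_ Dx).
Qed.

(** If [y] had values on both sides of [m], the intermediate value theorem between the two points
    would give a zero of [y - m]. *)
Lemma IVT_neq (R : realType) (a b : R) (y : R -> R) (m : R) :
  {in `]a, b[, continuous y} -> (forall c, c \in `]a, b[ -> y c != m) ->
  (forall c, c \in `]a, b[ -> m < y c) \/ (forall c, c \in `]a, b[ -> y c < m).
Proof.
move=> cy ym; apply: contrapT => /not_orP[/existsNP[p /not_implyP[pab /negP]]].
rewrite -leNgt => yp /existsNP[q /not_implyP[qab /negP]]; rewrite -leNgt => yq.
(* If the points come in the other order, negating both [y] and [m] restores the situation. *)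
wlog pq : y m cy ym p q pab qab yp yq / p <= q.
  move=> wl; have [|/ltW qp] := leP p q; first exact: wl yp yq.
  apply: (wl (fun x => - y x) (- m) _ _ _ _ qab pab _ _ qp); rewrite ?lerN2//.
  - by move=> x xab; apply: cvgN; exact: cy.
  - by move=> c cab; rewrite eqr_opp ym.
have sub : {subset `[p, q] <= `]a, b[}.
  move=> x; move: pab qab; rewrite !in_itv/= => /andP[ap _] /andP[_ qb].
  by move=> /andP[px xq]; rewrite (lt_le_trans ap)// (le_lt_trans xq).
have [||c cpq yc] := @IVT R y p q m pq.
- apply: continuous_in_subspaceT => x; rewrite inE/= => /sub; exact: cy.
- by rewrite ge_min yp le_max yq orbT.
- by have := ym c (sub _ cpq); rewrite yc eqxx.
Qed.

(** The weight [g] may be unbounded near the ends: [y] is bounded on the compact segment, so the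
    product stays integrable. This integrability is exported because it also carries the
    measurability of the product. *)
Lemma weighted_integral_mean_value (R : realType) (a b : R) (g y : R -> R) :
  a < b ->
  (@lebesgue_measure R).-integrable `]a, b[ (EFin \o g) ->
  {ae @lebesgue_measure R, forall x, `]a, b[%classic x -> 0 < g x} ->
  {within `[a, b], continuous y} ->
  (@lebesgue_measure R).-integrable `]a, b[ (EFin \o (fun x => g x * y x)) /\
  exists2 c, c \in `]a, b[ &
    \int[@lebesgue_measure R]_(x in `]a, b[) (g x * y x) =
    (\int[@lebesgue_measure R]_(x in `]a, b[) g x) * y c.
Proof.
move=> ab gi g_gt0 wcy.
have cy : {in `]a, b[, continuous y}.
  by have /(continuous_within_itvP _ ab)[] := wcy.
have mab : measurable `]a, b[%classic by exact: measurable_itv.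
have muab : (0 < @lebesgue_measure R `]a, b[%classic)%E.
  by rewrite lebesgue_measure_itv/= lte_fin ab -EFinB lte_fin subr_gt0.
have my : measurable_fun `]a, b[ y.
  by apply: open_continuous_measurable_fun => //; apply/in_continuous_mksetP.
have gyi : (@lebesgue_measure R).-integrable `]a, b[
    (EFin \o (fun x => g x * y x)).
  rewrite (_ : _ \o _ = ((EFin \o g) \* (EFin \o y))%E)//.
  apply: integrableMl => //.
  have /compact_bounded [M [Mr HM]] : compact (y @` `[a, b]).
    by apply: continuous_compact => //; exact: segment_compact.
  exists M; split => // N MN x /=; rewrite in_itv/= => /andP[ax xb].
  by apply: (HM N MN); exists x => //=; rewrite in_itv/= !ltW.
split => //.
pose K := \int[@lebesgue_measure R]_(x in `]a, b[) g x.
pose I := \int[@lebesgue_measure R]_(x in `]a, b[) (g x * y x).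
have K_gt0 : 0 < K by exact: Rintegral_gt0.
apply: contrapT => noc.
(* [I / K] is the weighted mean of [y], so [g * (y - I / K)] integrates to 0. The factor [s], later
   1 or -1, treats both signs at once. *)
have key (s : R) : ~ (forall c, c \in `]a, b[ -> 0 < s * (y c - I / K)).
  move=> sy.
  have gKi : (@lebesgue_measure R).-integrable `]a, b[
      (EFin \o (fun x => I / K * g x)) by exact: integrable_EFinZl.
  have hi : (@lebesgue_measure R).-integrable `]a, b[
      (EFin \o (fun x => g x * y x - I / K * g x)) by exact: integrable_EFinB.
  have : 0 < \int[@lebesgue_measure R]_(x in `]a, b[)
      (s * (g x * y x - I / K * g x)).
    apply: Rintegral_gt0 => //; first exact: integrable_EFinZl.
    move: g_gt0; apply: ae_imply => x gx xab.
    have -> : s * (g x * y x - I / K * g x) = g x * (s * (y x - I / K)).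
      by ring.
    by rewrite mulr_gt0 ?gx ?sy.
  rewrite RintegralZl// RintegralB// RintegralZl// -/K -/I divfK ?gt_eqF//.
  by rewrite subrr mulr0 ltxx.
have [|h|h] := @IVT_neq R a b y (I / K) cy.
- move=> c cab; apply/eqP => yc; apply: noc; exists c => //.
  by rewrite yc mulrC divfK// gt_eqF.
- by apply: (key 1) => c /h yc; rewrite mul1r subr_gt0.
- by apply: (key (-1)) => c /h yc; rewrite mulN1r oppr_gt0 subr_lt0.
Qed.

(** * The functional equation of the Gamma function *)

Lemma C1_FTC2 (R : realType) (a b : R) (F f : R -> R) : a < b ->
  {in `[a, b], forall x : R, is_derive x (1 : R) F (f x)} -> {in `[a, b], continuous f} ->
  (\int[@lebesgue_measure R]_(x in `[a, b]) (f x)%:E = (F b - F a)%:E)%E.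
Proof.
move=> ab dF cf; rewrite EFinB; apply: continuous_FTC2 => //.
- by apply: continuous_in_subspaceT => x; rewrite inE/= => /cf.
- have cF : {within `[a, b], continuous F}.
    by apply: derivable_within_continuous => x /dF [].
  have [_ ? ?] := (continuous_within_itvP _ ab).1 cF.
  by split => // x xab; have [] := dF _ (subset_itv_oo_cc xab).
- move=> x xab; rewrite derive1E.
  exact: (@derive_val _ _ _ _ _ _ _ (dF _ (subset_itv_oo_cc xab))).
Qed.

(** From [ln r < r] at [r = s / (2 * x)] follows [s^x <= (2x)^x e^(s/2)], so half of the exponential
    decay is left over. *)
Lemma powR_expRN_cvgy (R : realType) (x : R) : 0 < x ->
  s `^ x * expR (- s) @[s --> +oo] --> 0.
Proof.
move=> x_gt0; have x2_gt0 : 0 < 2 * x by rewrite mulr_gt0.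
have : (2 * x) `^ x * expR (- (s * 2^-1)) @[s --> +oo] --> (2 * x) `^ x * 0.
  apply: cvgMr; apply: (@cvg_comp _ _ _ (fun s : R => s * 2^-1)
    (fun s => expR (- s)) _ (pinfty_nbhs R)); last exact: cvgr_expR.
  by apply: gt0_cvgMly => //; rewrite invr_gt0.
rewrite mulr0; apply: (squeeze_cvgr _ (cvg_cst 0)).
near=> s.
have s_gt0 : 0 < s by near: s; exact: nbhs_pinfty_gt.
rewrite mulr_ge0 ?powR_ge0 ?expR_ge0//=.
have -> : s `^ x = (2 * x) `^ x * (s / (2 * x)) `^ x.
  rewrite -powRM ?divr_ge0 ?ltW//; congr (_ `^ _).
  by field; rewrite gt_eqF.
rewrite -mulrA ler_wpM2l ?powR_ge0//.
rewrite /powR gt_eqF ?divr_gt0// -expRD ler_expR.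
have : ln (s / (2 * x)) < s / (2 * x) by apply: ln_sublinear; rewrite divr_gt0.
rewrite -(ltr_pM2l x_gt0) => /ltW.
have -> : x * (s / (2 * x)) = s * 2^-1 by field; rewrite gt_eqF.
by lra.
Unshelve. all: by end_near. Qed.

Lemma continuous_powR_expRN (R : realType) (x : R) :
  {in `]0, +oo[, continuous (fun s : R => s `^ x * expR (- s))}.
Proof.
move=> s s_gt0.
have cx : {for s, continuous (fun s : R => s `^ x)}.
  by apply/differentiable_continuous/derivable1_diffP/derivable_powR.
apply: cvgM; first exact: cx.
by apply: (cvg_comp _ _ (cvgN cvg_id)); exact: continuous_expR.
Qed.

(* Holds even without knowing that the integrals converge: a divergent one is
   read as 0 by [fine], and both sides then vanish. *)
Lemma GammaS (R : realType) (x : R) : 0 < x -> Gamma (x + 1) = x * Gamma x.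
Proof.
move=> x_gt0; rewrite /Gamma /Rintegral addrK.
pose k (z s : R) := s `^ z * expR (- s).
(* Compact exhaustion of the half-line; [n.+2] instead of [n.+1] ensures [a 0 < b 0]. *)
pose a n : R := n.+1%:R^-1; pose b n : R := n.+2%:R.
pose E n := `[a n, b n]%classic.
have a_gt0 n : 0 < a n by rewrite invr_gt0.
have a_le1 n : a n <= 1 by rewrite invf_le1 ?ler1n.
have ab n : a n < b n by rewrite (le_lt_trans (a_le1 n))// ltr1n.
have E_gt0 n s : s \in `[a n, b n] -> s \in `]0, +oo[.
  by rewrite !in_itv/= andbT => /andP[+ _]; exact: lt_le_trans.
(* Monotone convergence: the integrand is nonnegative, so the limit holds in the extended reals even
   if it is infinite. *)
have k_cvg z : (\int[@lebesgue_measure R]_(s in E n) (k z s)%:E)%E @[n --> \oo]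
    --> (\int[@lebesgue_measure R]_(s in `]0%R, +oo[) (k z s)%:E)%E.
  rewrite (_ : `]0%R, +oo[%classic = \bigcup_n E n); last first.
    apply/seteqP; split => s /=.
      rewrite in_itv/= andbT => s_gt0.
      near \oo => n; exists n => //; rewrite /E/= in_itv/=; apply/andP; split.
        rewrite -(invrK s) lef_pV2 ?posrE ?invr_gt0// -natr1 ler_wpDr//.
        by near: n; exact: nbhs_infty_ger.
      rewrite /b -natr1 ler_wpDr// -natr1 ler_wpDr//.
      by near: n; exact: nbhs_infty_ger.
    by move=> [n _] /E_gt0.
  apply: ge0_nondecreasing_set_cvg_integral => //.
  - move=> m n mn; apply/subsetPset => s; rewrite /E/= !in_itv/= => /andP[ms sm].
    apply/andP; split.
      by rewrite (le_trans _ ms)// lef_pV2 ?posrE// ler_nat ltnS.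
    by rewrite (le_trans sm)// ler_nat !ltnS.
  - by move=> n; exact: measurable_itv.
  - move=> n; apply/measurable_EFinP.
    apply: subspace_continuous_measurable_fun; first exact: measurable_itv.
    apply: continuous_in_subspaceT => s; rewrite inE/= => /E_gt0.
    exact: continuous_powR_expRN.
  - by move=> n s _; rewrite lee_fin mulr_ge0 ?powR_ge0 ?expR_ge0.
have k_int z n : (@lebesgue_measure R).-integrable (E n) (EFin \o k z).
  apply: continuous_compact_integrable; first exact: segment_compact.
  apply: continuous_in_subspaceT => s; rewrite inE/= => /E_gt0.
  exact: continuous_powR_expRN.
(* Integration by parts: the derivative of [k x] is [x * k (x - 1) - k x]. *)
have part n : (\int[@lebesgue_measure R]_(s in E n) (k x s)%:E =
    x%:E * \int[@lebesgue_measure R]_(s in E n) (k (x - 1) s)%:E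
    + (k x (a n) - k x (b n))%:E)%E.
  have : (\int[@lebesgue_measure R]_(s in E n) (x * k (x - 1) s - k x s)%:E =
      (k x (b n) - k x (a n))%:E)%E.
    apply: C1_FTC2 => // s sE; have s_in := E_gt0 _ _ sE.
      have s_gt0 : 0 < s by move: s_in; rewrite in_itv/= andbT.
      have d_powR := is_derive1_powR x s_gt0.
      have d_expR : is_derive s (1 : R) (expR \o -%R) (expR (- s) * -1).
        exact: is_derive1_comp.
      apply: (is_derive_eq (is_deriveM d_powR d_expR)).
      by rewrite /k /GRing.scale/=; ring.
    apply: cvgB; last exact: continuous_powR_expRN.
    by apply: cvgMr; exact: continuous_powR_expRN.
  have k_fin z :
      (\int[@lebesgue_measure R]_(s in E n) (k z s)%:E)%E \is a fin_num.
    by apply: integrable_fin_num; [rewrite /E; exact: measurable_itv|exact: (k_int z n)].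
  have mE : measurable (E n) by exact: measurable_itv.
  have iN := k_int x n.
  have iZ : (@lebesgue_measure R).-integrable (E n)
      (EFin \o (fun s => x * k (x - 1) s)) by exact: integrable_EFinZl.
  rewrite integralB_EFin//.
  under eq_integral do rewrite /= EFinM.
  rewrite integralZl//; last exact: (k_int (x - 1) n).
  rewrite -(fineK (k_fin x)) -(fineK (k_fin (x - 1))).
  rewrite -EFinM -EFinB => -[eqxk]; rewrite -EFinD; congr EFin.
  by rewrite -(opprB (k x (b n))) -eqxk; ring.
(* At the lower end [s^x] tends to 0 because [x > 0]; at the upper end the exponential wins. *)
have bound_cvg : (k x (a n) - k x (b n))%:E @[n --> \oo] --> 0%E.
  rewrite -[0%E]/(0%:E) -(subr0 0); apply: cvg_EFin; first exact: nearW.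
  apply: cvgB.
    have : k x s @[s --> 0^'+] --> 0 * expR (- 0).
      apply: cvgM; first exact: powR_cvg0.
      apply: cvg_at_right_filter; apply: (cvg_comp _ _ (cvgN cvg_id)).
      exact: continuous_expR.
    by rewrite mul0r => /cvg_at_rightP; apply; split => //; exact: cvg_harmonic.
  have /cvg_pinftyP := powR_expRN_cvgy R x x_gt0; apply.
  apply/cvgryPge => r; near=> n; rewrite /b -natr1 ler_wpDr// -natr1 ler_wpDr//.
  by near: n; exact: nbhs_infty_ger.
have := k_cvg x; under eq_cvg do rewrite part.
have : (x%:E * \int[@lebesgue_measure R]_(s in E n) (k (x - 1) s)%:E
    + (k x (a n) - k x (b n))%:E)%E @[n --> \oo] -->
    (x%:E * \int[@lebesgue_measure R]_(s in `]0%R, +oo[) (k (x - 1) s)%:E + 0)%E.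
  by apply: cvgeD => //; [exact: fin_num_adde_defl|exact: cvgeZl].
move=> /cvg_unique /[apply] => /(_ (@ereal_hausdorff R)) <-.
rewrite adde0; case: (\int[_]_(_ in _) _)%E => [r||] //=.
- by rewrite gt0_muley ?lte_fin// mulr0.
- by rewrite gt0_muleNy ?lte_fin// mulr0.
Unshelve. all: by end_near. Qed.

(** * Rising factorials, the series [P] and the primitive [H] *)

(** The Pochhammer symbol, with value 1 at [n = 0]. *)
Definition rising (R : realType) (a : R) (n : nat) : R :=
  \prod_(i < n) (a + i%:R).

Lemma risingS (R : realType) (a : R) (n : nat) :
  rising R a n.+1 = rising R a n * (a + n%:R).
Proof. by rewrite /rising big_ord_recr. Qed.

Lemma rising_gt0 (R : realType) (a : R) (n : nat) : 0 < a -> 0 < rising R a n.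
Proof. by move=> a_gt0; apply: prodr_gt0 => i _; rewrite ltr_wpDr. Qed.

Lemma GammaDn (R : realType) (a : R) (n : nat) : 0 < a ->
  Gamma (a + n%:R) = rising R a n * Gamma a.
Proof.
move=> a_gt0; elim: n => [|n IHn]; first by rewrite addr0 /rising big_ord0 mul1r.
by rewrite -natr1 addrA GammaS ?ltr_wpDr// IHn risingS mulrA (mulrC (a + _)).
Qed.

(** The coefficients of [P]: the index [k.+1] makes the factors run from [a] to [a + k]. *)
Definition rising_coef (R : realType) (a : R) (k : nat) : R :=
  (rising R a k.+1)^-1.

(** This is [(a + k + 1) c_(k+1) = c_k], rearranged so that the left side is a coefficient of the
    formal derivative. *)
Lemma rising_coefS (R : realType) (a : R) (k : nat) : 0 < a ->
  k.+1%:R * rising_coef R a k.+1 = rising_coef R a k - a * rising_coef R a k.+1.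
Proof.
move=> a_gt0; have ak_neq0 : a + k.+1%:R != 0 by rewrite gt_eqF// ltr_wpDr.
rewrite /rising_coef (risingS R a k.+1) -[X in X * _](addrK a) (addrC k.+1%:R).
by rewrite invfM mulrBl mulrCA mulfV// mulr1.
Qed.

(* Unlike mere convergence, this domination passes to formal derivatives, which
   yields all the convergence hypotheses of [pseries_snd_diffs]. *)
Lemma is_cvg_pseries_expR_dom (R : realType) (C : R) (c : nat -> R) (x : R) :
  (forall k, `|c k| <= C * (k`!%:R)^-1) -> cvgn (pseries c x).
Proof.
move=> cC; apply: normed_cvg.
apply: (@series_le_cvg _ _ (fun k => C * exp_coeff `|x| k)) => [k|k|k|].
- exact: normr_ge0.
- rewrite mulr_ge0 ?exp_coeff_ge0//.
  by have := le_trans (normr_ge0 _) (cC 0%N); rewrite fact0 invr1 mulr1.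
- by rewrite /= normrM normrX exp_coeffE/= mulrA ler_wpM2r ?exprn_ge0.
- by apply: is_cvg_seriesZ; exact: is_cvg_series_exp_coeff.
Qed.

(** The factor [k + 1] cancels against (k + 1)!, so even the constant [C] is preserved. *)
Lemma pseries_diffs_expR_dom (R : realType) (C : R) (c : nat -> R) :
  (forall k, `|c k| <= C * (k`!%:R)^-1) ->
  forall k, `|pseries_diffs c k| <= C * (k`!%:R)^-1.
Proof.
move=> cC k; rewrite /pseries_diffs normrM normr_nat.
apply: (le_trans (ler_wpM2l _ (cC k.+1))); first exact: ler0n.
by rewrite factS natrM invfM mulrCA mulVKf// pnatr_eq0.
Qed.

(** The first factor [a] supplies [a^-1], and every later one satisfies [a + i >= i]. *)
Lemma rising_coef_dom (R : realType) (a : R) (k : nat) : 0 < a ->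
  `|rising_coef R a k| <= a^-1 * (k`!%:R)^-1.
Proof.
move=> a_gt0; rewrite ger0_norm; last by rewrite invr_ge0 ltW ?rising_gt0.
elim: k => [|k IHk].
  by rewrite /rising_coef risingS /rising big_ord0 mul1r addr0 fact0 invr1 mulr1.
rewrite /rising_coef risingS factS natrM !invfM mulrA mulrAC ler_pM//.
- by rewrite invr_ge0 ltW ?rising_gt0.
- by rewrite invr_ge0 addr_ge0// ltW.
- by rewrite lef_pV2 ?posrE ?ltr_wpDr// lerDr ltW.
Qed.

(* The series P of the header. *)
Definition rising_pseries (R : realType) (a z : R) : R :=
  limn (pseries (rising_coef R a) z).

Lemma is_derive_rising_pseries (R : realType) (a z : R) : 0 < a ->
  is_derive z (1 : R) (rising_pseries R a)
    (limn (pseries (pseries_diffs (rising_coef R a)) z)).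
Proof.
move=> a_gt0; have dom k := rising_coef_dom R a k a_gt0.
(* Any radius beyond [|z|] would do, since the three series converge everywhere. *)
apply: (@pseries_snd_diffs _ _ (`|z| + 1)).
- exact: is_cvg_pseries_expR_dom dom.
- exact: is_cvg_pseries_expR_dom (pseries_diffs_expR_dom _ _ _ dom).
- apply: is_cvg_pseries_expR_dom; do 2!apply: pseries_diffs_expR_dom.
  exact: dom.
- by rewrite [ltRHS]ger0_norm ?addr_ge0// ltrDl.
Qed.

(** The coefficient recurrence summed over all degrees; the constant 1 is [a] times the coefficient
    of index 0. *)
Lemma rising_pseries_ode (R : realType) (a z : R) : 0 < a ->
  z * limn (pseries (pseries_diffs (rising_coef R a)) z) =
  1 + z * rising_pseries R a z - a * rising_pseries R a z.
Proof.
move=> a_gt0; have dom k := rising_coef_dom R a k a_gt0.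
have cP := is_cvg_pseries_expR_dom _ _ _ z dom.
have cQ := is_cvg_pseries_expR_dom _ _ _ z (pseries_diffs_expR_dom _ _ _ dom).
(* The first [n] terms of the formal derivative involve coefficients up to index [n], so the last
   sum runs one term further. *)
have partial n : z * pseries (pseries_diffs (rising_coef R a)) z n =
    1 + z * pseries (rising_coef R a) z n
      - a * pseries (rising_coef R a) z n.+1.
  rewrite /pseries /series/=.
  elim: n => [|n IHn].
    rewrite big_nat1 !big_geq// expr0 mulr1 !mulr0 addr0.
    by rewrite /rising_coef risingS /rising big_ord0 mul1r addr0 divff ?subrr// gt_eqF.
  rewrite !(big_nat_recr n)//= (big_nat_recr n.+1)//= !mulrDr IHn.
  rewrite /pseries_diffs (rising_coefS R a n a_gt0) exprS; ring.
have : z * pseries (pseries_diffs (rising_coef R a)) z n @[n --> \oo] -->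
    z * limn (pseries (pseries_diffs (rising_coef R a)) z) by exact: cvgMr.
under eq_cvg do rewrite partial.
have cPS : pseries (rising_coef R a) z n.+1 @[n --> \oo] --> rising_pseries R a z.
  by rewrite (cvg_shiftS (pseries (rising_coef R a) z)).
move=> /cvg_unique; apply => //.
by apply: cvgB; [apply: cvgD; [exact: cvg_cst|exact: cvgMr]|exact: cvgMr].
Qed.

(** Termwise, [Gamma (k + a + 1)] is [rising a k.+1] times [Gamma a], and the common factor leaves
    the series. *)
Lemma mittag_lefflerE (R : realType) (a z : R) : 0 < a ->
  mittag_leffler 1 (a + 1) z = (Gamma a)^-1 * rising_pseries R a z.
Proof.
move=> a_gt0; have cP := is_cvg_pseries_expR_dom _ _ _ z
  (fun k => rising_coef_dom R a k a_gt0).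
apply/cvg_lim => //.
have -> : series (fun k => z ^+ k / Gamma (1 * k%:R + (a + 1))) =
    (fun n => (Gamma a)^-1 * pseries (rising_coef R a) z n).
  apply/funext => n; rewrite /pseries /series/= mulr_sumr.
  apply: eq_bigr => k _; rewrite mul1r addrCA natr1 GammaDn// invfM.
  by rewrite /rising_coef; ring.
exact: cvgMr.
Qed.

(* The function H of the header, Gamma alpha times the factor of y(c). *)
Definition tempered_primitive (R : realType) (a lambda u : R) : R :=
  u `^ a * expR (- lambda * u) * rising_pseries R a (lambda * u).

Lemma is_derive_tempered_primitive (R : realType) (a lambda u : R) :
  0 < a -> 0 < u ->
  is_derive u (1 : R) (tempered_primitive R a lambda)
    (u `^ (a - 1) * expR (- lambda * u)).
Proof.
move=> a_gt0 u_gt0.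
have d_lin c : is_derive u (1 : R) ( *%R c) c.
  apply: (is_derive_eq (is_deriveZ c (is_derive_id u (1 : R)))).
  by rewrite /GRing.scale/= mulr1.
have d_powR := is_derive1_powR a u_gt0.
have d_expR : is_derive u (1 : R) (expR \o *%R (- lambda))
    (expR (- lambda * u) * - lambda).
  exact: is_derive1_comp.
have d_ser : is_derive u (1 : R) (rising_pseries R a \o *%R lambda)
    (limn (pseries (pseries_diffs (rising_coef R a)) (lambda * u)) * lambda).
  by apply: is_derive1_comp; exact: is_derive_rising_pseries.
apply: (is_derive_eq (is_deriveM (is_deriveM d_powR d_expR) d_ser)).
rewrite /GRing.scale/=.
have u_a : u `^ a = u * u `^ (a - 1).
  rewrite -{2}(powRr1 (ltW u_gt0)) -powRD ?(gt_eqF u_gt0) ?implybT//.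
  by rewrite addrC subrK.
have ode := rising_pseries_ode R a (lambda * u) a_gt0.
rewrite !fctE/= u_a.
set Q := limn _ in ode *; set P := rising_pseries _ _ _ in ode *.
set E := expR _; set W := u `^ (a - 1).
(* With [z = lambda * u], the product rule leaves the kernel times [z * Q - z * P + a * P], and this
   bracket is 1 by the differential equation. *)
transitivity (W * E * (lambda * u * Q - lambda * u * P + a * P)); first by ring.
by rewrite ode; ring.
Qed.

(** This gives the boundary value of [H] for [s = t]: [u^a] tends to 0 even when the kernel blows up
    there, which happens for [a < 1]. *)
Lemma tempered_primitive_cvg0 (R : realType) (a lambda : R) : 0 < a ->
  tempered_primitive R a lambda u @[u --> 0^'+] --> 0.
Proof.
move=> a_gt0.
suff : tempered_primitive R a lambda u @[u --> 0^'+] -->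
    0 * expR (- lambda * 0) * rising_pseries R a (lambda * 0) by rewrite !mul0r.
apply: cvgM; first apply: cvgM; first exact: powR_cvg0.
- apply: cvg_at_right_filter.
  apply: (@continuous_comp R R R ( *%R (- lambda)) expR 0).
    exact: mulrl_continuous.
  exact: continuous_expR.
- apply: cvg_at_right_filter.
  apply: (@continuous_comp R R R ( *%R lambda) (rising_pseries R a) 0).
    exact: mulrl_continuous.
  apply/differentiable_continuous/derivable1_diffP.
  by have [] := is_derive_rising_pseries R a (lambda * 0) a_gt0.
Qed.

(** * One-sided derivatives and smoothness on a closed interval *)

(** Write [f z] as [f x] plus the difference quotient times [z - x], whose last factor tends to
    0. *)
Lemma is_derive_within_cvg (R : realType) (A : set R) (f : R -> R) (x d : R) :
  is_derive_within A f x d -> f z @[z --> within A (nbhs x)] --> f x.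
Proof.
move=> fd.
have : f x + (f z - f x) / (z - x) * (z - x) @[z --> within A x^'] -->
    f x + d * (x - x).
  apply: cvgD; first exact: cvg_cst.
  apply: cvgM => //; apply: cvgB; last exact: cvg_cst.
  do 2!apply: cvg_within_filter; exact: cvg_id.
rewrite subrr mulr0 addr0 => /cvgrPdist_lt fx; apply/cvgrPdist_lt => e e_gt0.
have := fx _ e_gt0; rewrite !near_withinE; apply: filterS => z.
(* The limit just obtained concerns the punctured filter; the point [z = x] is added here. *)
have [->|zx] := eqVneq z x; first by rewrite subrr normr0.
rewrite divfK ?subr_eq0//.
have -> : f x + (f z - f x) = f z by ring.
exact.
Qed.

(** Near an interior point membership in [A] is automatic, so the relative limit is the two-sided
    one. *)
Lemma is_derive_within_interior (R : realType) (A : set R) (f : R -> R)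
    (x d : R) : A° x -> is_derive_within A f x d -> is_derive x (1 : R) f d.
Proof.
move=> Ax fd; suff hd : h^-1 *: ((f \o shift x) (h *: 1) - f x) @[h --> 0^'] --> d.
  split; first by apply/cvg_ex; exists d.
  exact: cvg_lim hd.
apply/cvgrPdist_lt => e e_gt0; have /cvgrPdist_lt /(_ _ e_gt0) := fd.
rewrite !near_withinE => fde.
have : \forall z \near x, z != x -> `|d - (f z - f x) / (z - x)| < e.
  by apply: filterS2 fde Ax => z fz Az zx; exact: fz.
rewrite nbhs0P; apply: filterS => h fh h_neq0.
rewrite /= /GRing.scale/= mulr1 mulrC.
by move: fh; rewrite (addrC x) addrK; apply; rewrite -subr_eq0 addrK.
Qed.

(** The continuity of [D 1] comes from the existence of [D 2]. Two-sided derivatives are obtained at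
    interior points, while the continuity of [f] reaches the endpoints. *)
Lemma smooth_on_C1 (R : realType) (a b : R) (f : R -> R) : a < b ->
  smooth_on a b f -> exists f' : R -> R,
    [/\ {in `]a, b[, forall x : R, is_derive x (1 : R) f (f' x)},
        {in `]a, b[, continuous f'} & {within `[a, b], continuous f}].
Proof.
move=> ab [D [D0 Dn]]; exists (D 1%N).
have int x : x \in `]a, b[ -> `[a, b]%classic° x.
  move=> xab; have := near_in_itvoo xab; apply: filterS => z zab.
  exact: subset_itv_oo_cc.
have D'S n x : x \in `]a, b[ -> is_derive x (1 : R) (D n) (D n.+1 x).
  move=> xab; apply: (is_derive_within_interior R _ _ _ _ (int x xab)).
  by apply: Dn; exact: subset_itv_oo_cc.
split.
- move=> x xab; apply: near_eq_is_derive (D'S 0%N x xab).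
  by have := near_in_itvoo xab; apply: filterS => z /subset_itv_oo_cc /D0.
- move=> x xab; apply/differentiable_continuous/derivable1_diffP.
  by have [] := D'S 1%N x xab.
- apply/subspace_continuousP => x xab.
  suff : f z @[z --> within `[a, b] (nbhs x)] --> D 0%N x by rewrite D0.
  have := is_derive_within_cvg R _ _ _ _ (Dn 0%N x xab).
  apply: cvg_trans; apply: near_eq_cvg; rewrite near_withinE.
  by apply: nearW => z zab; rewrite D0.
Qed.

(** * Integration up to open endpoints, and strict monotonicity *)

(** The fundamental theorem on compact subintervals passes to the limit by monotone convergence.
    Hence [f] may be singular at the ends, as the kernel can be at [t] for [alpha < 1]. *)
Lemma ge0_FTC2_oo (R : realType) (a b la lb : R) (F f : R -> R) : a < b ->
  {in `]a, b[, forall x : R, is_derive x (1 : R) F (f x)} ->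
  {in `]a, b[, continuous f} -> {in `]a, b[, forall x, 0 <= f x} ->
  F x @[x --> a^'+] --> la -> F x @[x --> b^'-] --> lb ->
  (\int[@lebesgue_measure R]_(x in `]a, b[) (f x)%:E = (lb - la)%:E)%E.
Proof.
move=> ab dF cf f_ge0 Fa Fb.
(* At most a third of the length, so that [E n] is nondegenerate already at [n = 0]. *)
pose e n := (b - a) * n.+3%:R^-1.
pose E n := `[a + e n, b - e n]%classic.
have e_gt0 n : 0 < e n by rewrite mulr_gt0 ?subr_gt0.
have e_le n : e n <= (b - a) / 3.
  by rewrite ler_wpM2l ?subr_ge0 ?(ltW ab)// lef_pV2 ?posrE// ler_nat.
have e_cvg : e n @[n --> \oo] --> 0.
  rewrite -(mulr0 (b - a)); apply: cvgMr.
  have := @cvg_harmonic R; rewrite -(cvg_shiftn 2); apply: cvg_trans.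
  by apply: near_eq_cvg; apply: nearW => n; rewrite /= addn2.
have Eab n : a + e n < b - e n by have := e_le n; have := e_gt0 n; lra.
have E_sub n x : x \in `[a + e n, b - e n] -> x \in `]a, b[.
  rewrite !in_itv/= => /andP[ax xb]; have := e_gt0 n => en.
  by rewrite (lt_le_trans _ ax) ?ltrDl//= (le_lt_trans xb)// gtrBl.
have : (\int[@lebesgue_measure R]_(x in E n) (f x)%:E)%E @[n --> \oo] -->
    (\int[@lebesgue_measure R]_(x in `]a, b[) (f x)%:E)%E.
  rewrite (_ : `]a, b[%classic = \bigcup_n E n); last first.
    apply/seteqP; split => x; last by move=> [n _] /E_sub.
    rewrite /= in_itv/= => /andP[ax xb].
    have /cvgrPdist_lt e_small := e_cvg.
    near \oo => n; exists n => //; rewrite /E/= in_itv/=.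
    have : `|0 - e n| < Num.min (x - a) (b - x).
      by near: n; apply: e_small; rewrite lt_min !subr_gt0 ax.
    rewrite sub0r normrN gtr0_norm// lt_min => /andP[]; lra.
  apply: ge0_nondecreasing_set_cvg_integral => //.
  - move=> m n mn; apply/subsetPset => x; rewrite /E/= !in_itv/=.
    have : e n <= e m.
      by rewrite ler_wpM2l ?subr_ge0 ?(ltW ab)// lef_pV2 ?posrE// ler_nat !ltnS.
    by move=> ? /andP[? ?]; apply/andP; split; lra.
  - by move=> n; exact: measurable_itv.
  - move=> n; apply/measurable_EFinP.
    apply: subspace_continuous_measurable_fun; first exact: measurable_itv.
    by apply: continuous_in_subspaceT => x; rewrite inE/= => /E_sub /cf.
  - by move=> n x /E_sub /f_ge0; rewrite lee_fin.
under eq_cvg => n.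
  rewrite (@C1_FTC2 R _ _ F f (Eab n)); [|by move=> x /E_sub /dF|by move=> x /E_sub /cf].
  over.
move=> /cvg_unique; apply => //; apply: cvg_EFin; first exact: nearW.
apply: cvgB.
- move/cvg_at_leftP : Fb; apply; split => [n|]; first by rewrite gtrBl.
  by rewrite -[X in _ --> X]subr0; apply: cvgB => //; exact: cvg_cst.
- move/cvg_at_rightP : Fa; apply; split => [n|]; first by rewrite ltrDl.
  by rewrite -[X in _ --> X]addr0; apply: cvgD => //; exact: cvg_cst.
Unshelve. all: by end_near. Qed.

Lemma ge0_integrable_fin (d : measure_display) (T : measurableType d)
    (R : realType) (mu : {measure set T -> \bar R}) (D : set T) (f : T -> R)
    (r : R) :
  measurable D -> measurable_fun D f -> (forall x, D x -> 0 <= f x) ->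
  (\int[mu]_(x in D) (f x)%:E = r%:E)%E -> mu.-integrable D (EFin \o f).
Proof.
move=> mD mf f_ge0 fr; apply/integrableP; split; first exact/measurable_EFinP.
under eq_integral => x /set_mem Dx do rewrite /= ger0_norm ?f_ge0//.
by rewrite fr ltry.
Qed.

(** A nonempty open interval has positive length, hence is not negligible. *)
Lemma ae_itvoo_ex (R : realType) (a b : R) (P : R -> Prop) : a < b ->
  {ae @lebesgue_measure R, forall x, x \in `]a, b[ -> P x} ->
  exists2 x, x \in `]a, b[ & P x.
Proof.
move=> ab aeP; apply: contrapT => noP.
have : {ae @lebesgue_measure R, forall x, ~ `]a, b[%classic x}.
  by move: aeP; apply: ae_imply => x Px xab; apply: noP; exists x => //; exact: Px.
move=> nab; have : (@lebesgue_measure R `]a, b[%classic = 0)%E.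
  apply/negligibleP; first exact: measurable_itv.
  by move: nab; apply: negligibleS => x xab /(_ xab).
rewrite lebesgue_measure_itv/= lte_fin ab -EFinB => -[] /eqP.
by rewrite subr_eq0 gt_eqF.
Qed.

(** By continuity a negative value would persist on a whole interval, against positivity almost
    everywhere. *)
Lemma continuous_ae_ge0 (R : realType) (a b : R) (f : R -> R) :
  {in `]a, b[, continuous f} ->
  {ae @lebesgue_measure R, forall x, x \in `]a, b[ -> 0 < f x} ->
  {in `]a, b[, forall x, 0 <= f x}.
Proof.
move=> cf f_gt0 x xab; rewrite leNgt; apply/negP => fx_lt0.
have : \forall z \near x, (z \in `]a, b[) /\ f z < 0.
  near=> z; split; first by near: z; exact: near_in_itvoo.
  by near: z; apply: (cvgr_lt _ (cf x xab)).
move=> /nbhs_ballP[e /= e_gt0 xe].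
have in_xe z : z \in `]x, x + e[ -> (z \in `]a, b[) /\ f z < 0.
  rewrite in_itv/= => /andP[xz ze]; apply: xe.
  by rewrite /ball/= distrC ger0_norm ?subr_ge0 ?ltW// ltrBlDl.
have [||z /in_xe[_ fz] fz_gt0] := @ae_itvoo_ex R x (x + e) (fun z => 0 < f z).
- by rewrite ltrDl.
- by move: f_gt0; apply: ae_imply => z fz /in_xe[/fz].
- by have := lt_trans fz fz_gt0; rewrite ltxx.
Unshelve. all: by end_near. Qed.

(** The increment of [f] is the integral of [f'], which is strictly positive. A mean value argument
    would not give strictness, since [f'] may vanish on a null set. *)
Lemma C1_ae_gt0_increasing (R : realType) (a b : R) (f f' : R -> R) :
  {in `]a, b[, forall x : R, is_derive x (1 : R) f (f' x)} ->
  {in `]a, b[, continuous f'} -> {within `[a, b], continuous f} ->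
  {ae @lebesgue_measure R, forall x, x \in `]a, b[ -> 0 < f' x} ->
  {in `[a, b] &, {homo f : x y / x < y}}.
Proof.
move=> df cf' cf f'_gt0 c d cab dab cd.
have f'_ge0 := continuous_ae_ge0 R a b f' cf' f'_gt0.
have cd_ab x : x \in `]c, d[ -> x \in `]a, b[.
  by apply: subset_itvSoo; rewrite bnd_simp ?(itvP cab) ?(itvP dab).
have cfcd : {within `[c, d], continuous f}.
  apply: continuous_subspaceW cf; apply: subset_itvScc.
    by rewrite bnd_simp (itvP cab).
  by rewrite bnd_simp (itvP dab).
have [_ fc fd] := (continuous_within_itvP _ cd).1 cfcd.
have cf'cd : {in `]c, d[, continuous f'} by move=> x /cd_ab /cf'.
have f'_ge0cd : {in `]c, d[, forall x, 0 <= f' x} by move=> x /cd_ab /f'_ge0.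
have FTC : (\int[@lebesgue_measure R]_(x in `]c, d[) (f' x)%:E =
    (f d - f c)%:E)%E.
  by apply: (ge0_FTC2_oo R c d (f c) (f d) f f') => // x /cd_ab /df.
rewrite -subr_gt0.
have -> : f d - f c = \int[@lebesgue_measure R]_(x in `]c, d[) f' x.
  by rewrite /Rintegral FTC.
have mucd : (0 < @lebesgue_measure R `]c, d[%classic)%E.
  by rewrite lebesgue_measure_itv/= lte_fin cd -EFinB lte_fin subr_gt0.
apply: Rintegral_gt0 => //.
- apply: ge0_integrable_fin FTC => //.
  by apply: open_continuous_measurable_fun => //; exact/in_continuous_mksetP.
- by move: f'_gt0; apply: ae_imply => x f'x /cd_ab /f'x.
Qed.

Theorem theorem4p1 (R : realType) (b : R) (b_gt0 : 0 < b)
  (Psi : R -> R)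
  (Psi_smooth : smooth_on 0 b Psi)
  (Psi_monotonic : monotonic_on 0 b Psi)
  (dPsi_gt0 : {ae @lebesgue_measure R, forall x, x \in `[0, b] -> 0 < Psi^`()%classic x})
  (alpha lambda : R) (alpha_gt0 : 0 < alpha)
  (y : R -> R) (y_continuous : {within `[0, b], continuous y})
  (t : R) (t_gt0 : 0 < t) (t_le_b : t <= b) :
  exists c : R, [/\ 0 < c, c < t &
    tempered_integral Psi alpha lambda y t =
    (Psi t - Psi 0) `^ alpha * expR (- lambda * (Psi t - Psi 0)) *
    mittag_leffler 1 (alpha + 1) (lambda * (Psi t - Psi 0)) * y c].
Proof.
have [dPsi [dPsiE cdPsi cPsi]] := smooth_on_C1 R 0 b Psi b_gt0 Psi_smooth.
have Psi'E : {in `]0, b[, Psi^`()%classic =1 dPsi}.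
  by move=> x /dPsiE dx; rewrite derive1E; exact: derive_val.
have dPsi_gt0' : {ae @lebesgue_measure R, forall x, x \in `]0, b[ -> 0 < dPsi x}.
  move: dPsi_gt0; apply: ae_imply => x dx xb.
  by rewrite -Psi'E ?dx//; exact: subset_itv_oo_cc.
have dPsi_ge0 := continuous_ae_ge0 R 0 b dPsi cdPsi dPsi_gt0'.
have Psi_inc := C1_ae_gt0_increasing R 0 b Psi dPsi dPsiE cdPsi cPsi dPsi_gt0'.
have t_b (x : R) : x \in `]0, t[ -> x \in `]0, b[.
  by apply: subset_itvSoo; rewrite bnd_simp.
have t_bc (x : R) : x \in `[0, t] -> x \in `[0, b].
  by apply: subset_itvScc; rewrite bnd_simp.
pose w s := Psi t - Psi s.
(* Strict growth of [Psi] makes the base of the power positive before [t]; the point 0 is included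
   for the boundary value at the lower end. *)
have w_gt0 (x : R) : x \in `[0, t[ -> 0 < w x.
  rewrite in_itv/= => /andP[x_ge0 xt]; rewrite subr_gt0 Psi_inc//.
    by rewrite in_itv/= x_ge0 (le_trans (ltW xt)).
  by rewrite in_itv/= ltW.
have w_gt0' (x : R) : x \in `]0, t[ -> 0 < w x.
  by move=> xt; apply: w_gt0; move: xt; rewrite !in_itv/= => /andP[/ltW -> ->].
pose ker u := u `^ (alpha - 1) * expR (- lambda * u).
pose g s := dPsi s * ker (w s).
have dw (x : R) : x \in `]0, t[ -> is_derive x (1 : R) w (- dPsi x).
  move=> /t_b /dPsiE dx.
  by apply: (is_derive_eq (is_deriveB (is_derive_cst (Psi t) x (1 : R)) dx));
    rewrite sub0r.
have dH (u : R) : 0 < u -> is_derive u (1 : R) (tempered_primitive R alpha lambda) (ker u).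
  exact: is_derive_tempered_primitive.
have dG (x : R) : x \in `]0, t[ ->
    is_derive x (1 : R) (- (tempered_primitive R alpha lambda \o w)) (g x).
  move=> xt; have dHw := is_derive1_comp (dH _ (w_gt0' x xt)) (dw x xt).
  by apply: (is_derive_eq (is_deriveN dHw)); rewrite /g mulrN opprK mulrC.
have cg : {in `]0, t[, continuous g}.
  move=> x xt; have cw : {for x, continuous w}.
    by apply/differentiable_continuous/derivable1_diffP; have [] := dw x xt.
  apply: cvgM; first exact: cdPsi (t_b x xt).
  apply: cvgM.
    apply: (@continuous_comp R R R w (fun u => u `^ (alpha - 1)) x cw).
    apply/differentiable_continuous/derivable1_diffP/derivable_powR.
    by rewrite in_itv/= andbT w_gt0'.
  apply: (@continuous_comp R R R (fun s => - lambda * w s) expR x).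
    by apply: cvgMr; exact: cw.
  exact: continuous_expR.
have ker_gt0 (u : R) : 0 < u -> 0 < ker u.
  by move=> u_gt0; rewrite mulr_gt0 ?powR_gt0 ?expR_gt0.
have g_ge0 : {in `]0, t[, forall x, 0 <= g x}.
  by move=> x xt; rewrite mulr_ge0 ?dPsi_ge0 ?t_b// ltW ?ker_gt0 ?w_gt0'.
have [_ Psi0 Psit] : [/\ {in `]0, t[, continuous Psi},
    Psi x @[x --> 0^'+] --> Psi 0 & Psi x @[x --> t^'-] --> Psi t].
  apply/(continuous_within_itvP _ t_gt0).
  by apply: continuous_subspaceW cPsi; exact: t_bc.
have w0_gt0 : 0 < w 0 by rewrite w_gt0// in_itv/= lexx.
have G0 : (- (tempered_primitive R alpha lambda \o w)) x @[x --> 0^'+] -->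
    - tempered_primitive R alpha lambda (w 0).
  apply: cvgN; apply: (@cvg_comp _ _ _ w (tempered_primitive R alpha lambda)).
    by apply: cvgB; [exact: cvg_cst|exact: Psi0].
  apply/differentiable_continuous/derivable1_diffP.
  by have [] := dH _ w0_gt0.
(* At [t] the argument reaches 0, where [H] is known to have a right limit; the strict decrease of
   [w] makes the approach come from the right. *)
have Gt : (- (tempered_primitive R alpha lambda \o w)) x @[x --> t^'-] --> - 0.
  apply: cvgN.
  apply: (@decreasing_cvg_at_left_comp R w (tempered_primitive R alpha lambda)
    (BLeft 0)).
  - by rewrite bnd_simp.
  - move=> x z xt zt xz; rewrite ltrD2l ltrN2 Psi_inc// t_bc//.
  - by apply: cvgB; [exact: cvg_cst|exact: Psit].
  - by rewrite /w subrr; exact: tempered_primitive_cvg0.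
(* The total weight is [H (w 0)]; its finiteness also yields the integrability of [g]. *)
have int_g := ge0_FTC2_oo R 0 t _ _ _ _ t_gt0 dG cg g_ge0 G0 Gt.
have gi : (@lebesgue_measure R).-integrable `]0, t[ (EFin \o g).
  apply: ge0_integrable_fin int_g => //.
  by apply: open_continuous_measurable_fun => //; exact/in_continuous_mksetP.
have g_gt0 : {ae @lebesgue_measure R, forall x, `]0, t[%classic x -> 0 < g x}.
  move: dPsi_gt0'; apply: ae_imply => x dx xt.
  by rewrite mulr_gt0 ?dx ?t_b// ker_gt0 ?w_gt0'.
have cy : {within `[0, t], continuous y}.
  by apply: continuous_subspaceW y_continuous; exact: t_bc.
have [gyi [c ct gyE]] :=
  weighted_integral_mean_value R 0 t g y t_gt0 gi g_gt0 cy.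
exists c; move: (ct); rewrite in_itv/= => /andP[c_gt0 c_lt]; split => //.
have hE x : x \in `]0, t[ -> g x * y x =
    Psi^`()%classic x * (Psi t - Psi x) `^ (alpha - 1) *
    expR (- lambda * (Psi t - Psi x)) * y x.
  by move=> xt; rewrite Psi'E ?t_b// /g /ker !mulrA.
have mgy := measurable_int _ gyi.
have mh : measurable_fun `]0, t[ (fun x => Psi^`()%classic x *
    (Psi t - Psi x) `^ (alpha - 1) * expR (- lambda * (Psi t - Psi x)) * y x).
  apply: (eq_measurable_fun (fun x => g x * y x)); last exact/measurable_EFinP.
  by move=> x; rewrite inE/= => /hE.
rewrite /tempered_integral mittag_lefflerE//.
(* The closed interval adds two points of measure zero, so only the open interval counts, where the
   derivative of [Psi] is [dPsi]. *)
have -> : \int[@lebesgue_measure R]_(s in `[0, t]) (Psi^`()%classic s *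
    (Psi t - Psi s) `^ (alpha - 1) * expR (- lambda * (Psi t - Psi s)) * y s) =
    \int[@lebesgue_measure R]_(x in `]0, t[) (g x * y x).
  rewrite /Rintegral integral_itv_bndoo; last exact/measurable_EFinP.
  by congr fine; apply: eq_integral => x; rewrite inE/= => /hE ->.
(* Both sides become [H (w 0) * y c] divided by [Gamma alpha]. *)
rewrite gyE {1}/Rintegral int_g/= oppr0 add0r opprK.
by rewrite /tempered_primitive /w; ring.
Qed.
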